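(* Let $C$ be a $d$-dimensional closed cube and let $f$ be an upper semicontinuous multivalued mapping from $C$ to nonempty, convex and compact subsets of $C$. Then there exists a point $x\in C$ such that $x\in f(x)$.
   Context: A multivalued map $f:X\to 2^Y$ is upper semicontinuous if $f(x)$ is compact for all $x\in X$, and for every $x\in X$ and every $\epsilon>0$ there exists $\delta>0$ such that if $z\in N_\delta(x)$ then $f(z)\subset N_\epsilon(f(x))$. Here $N_\delta(x)$ is the $\delta$-neighborhood of the point $x$ and $N_\epsilon(A)$ is the $\epsilon$-neighborhood of the set $A$. *)

(* Defs.v *)
From HB Require Import structures.
From mathcomp Require Import all_boot all_order all_algebra.
From mathcomp Require Import all_classical all_reals all_analysis.

Set Implicit Arguments.
Unset Strict Implicit.
Unset Printing Implicit Defensive.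

Import Order.TTheory GRing.Theory Num.Theory.
Import numFieldNormedType.Exports.

Local Open Scope classical_set_scope.
Local Open Scope ring_scope.

Definition set_neighborhood (R : realType) (Y : pseudoMetricType R)
    (e : R) (A : set Y) : set Y :=
  \bigcup_(a in A) ball a e.

Definition upper_semicontinuous (R : realType) (X Y : pseudoMetricType R)
    (f : X -> set Y) : Prop :=
  (forall x, compact (f x)) /\
  (forall (x : X) (e : R), 0 < e -> exists2 d : R, 0 < d &
     forall z, ball x d z -> f z `<=` set_neighborhood e (f x)).

(* The rows of [U], orthonormal in the definition below, are the directions of
   the edges at the vertex [p]; [s] is the side length. The cube need be neither
   axis-parallel nor full-dimensional in R^n. *)
Definition closed_cube (R : realType) (n d : nat)
    (p : 'rV[R]_n) (s : R) (U : 'M[R]_(d, n)) : set 'rV[R]_n :=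
  [set p + s *: (t *m U) |
     t in [set t : 'rV[R]_d | forall i, 0 <= t ord0 i <= 1]].

Definition is_closed_cube (R : realType) (n d : nat) (C : set 'rV[R]_n) : Prop :=
  exists (p : 'rV[R]_n) (s : R) (U : 'M[R]_(d, n)),
    [/\ 0 < s, U *m U^T = 1%:M & C = closed_cube p s U].

(* Main.v *)
(* In edge coordinates the cube is [0,1]^d.  Choose values of f on a fine grid
   and glue them with a partition of unity into a continuous self-map of
   [0,1]^d; a fixed point of it is a convex combination of values of f at nearby
   points.  Letting the grid get finer, a cluster point x of these fixed points
   lies in f x, since f is upper semicontinuous with closed convex values.

   Brouwer's theorem is proved by Kuhn's 0/1 labelling of the grid.  Freudenthal
   simplices tile the grid; the sum over them of the oriented volumes of their
   images under the label map is unchanged, by Stokes' formula, when a label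
   function is modified away from the faces where it is prescribed, so it can be
   computed for the labels [x_i > 0], where it equals d!.  Hence some simplex
   has a nondegenerate image: every label takes both values on it. *)
Require Import Defs.
From HB Require Import structures.
From mathcomp Require Import all_boot all_order all_algebra all_fingroup.
From mathcomp Require Import all_classical all_reals all_analysis.
From mathcomp Require Import zify ring lra.

Import Order.TTheory GRing.Theory Num.Theory.
Import numFieldNormedType.Exports.

Local Open Scope classical_set_scope.
Local Open Scope ring_scope.

Set Implicit Arguments.
Unset Strict Implicit.
Unset Printing Implicit Defensive.

(** * Kuhn's labelling lemma *)

Section KuhnDegree.
Variable R : numDomainType.

(** By linearity in row [i1], the determinant is [c] times one that has two rows of ones. *)
Lemma det_const_row n (A : 'M[R]_n) (i0 i1 : 'I_n) (c : R) :
  i0 != i1 -> (forall j, A i0 j = 1) -> (forall j, A i1 j = c) -> \det A = 0.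
Proof.
move=> ne A0 A1; pose B := \matrix_(i, j) if i == i1 then 1 else A i j.
have rowB : row' i1 B = row' i1 A.
  by apply/matrixP => i j; rewrite !mxE eq_sym (negbTE (neq_lift _ _)).
rewrite (@determinant_multilinear _ _ A B B i1 c 0) ?rowB //; last first.
  by apply/rowP => j; rewrite !mxE eqxx A1 mulr1 mul0r addr0.
rewrite (_ : \det B = 0) ?mulr0 ?addr0 //.
apply: (determinant_alternate ne) => j.
by rewrite !mxE eqxx (negbTE ne) A0.
Qed.

(** For [n = d.+1] the determinant is [d!] times the oriented volume of the simplex spanned by the
    label vectors of the points [w j]. *)
Definition label_mx d n (l : 'I_d -> ('I_d -> nat) -> R)
    (w : 'I_n -> 'I_d -> nat) : 'M[R]_(d.+1, n) :=
  \matrix_(i, j) if unlift ord0 i is Some k then l k (w j) else 1.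

Lemma label_mx0 d n l (w : 'I_n -> 'I_d -> nat) j : label_mx l w ord0 j = 1.
Proof. by rewrite mxE unlift_none. Qed.

Lemma label_mxS d n l (w : 'I_n -> 'I_d -> nat) k j :
  label_mx l w (lift ord0 k) j = l k (w j).
Proof. by rewrite mxE liftK. Qed.

(** Up to a constant and a sign, the integral of [x_k] times the wedge of the other [dx_i] over the
    image of the facet: the sum is [d] times the mean of [x_k] on it. *)
Definition facet_form d (l : 'I_d -> ('I_d -> nat) -> R) (k : 'I_d)
    (w : 'I_d -> 'I_d -> nat) : R :=
  (\sum_m l k (w m)) * \det (row' (lift ord0 k) (label_mx l w)).

(* Leibniz rule d(mu . omega) = d mu /\ omega: expand the determinant along row
   [k] and use that the cofactors of that row sum to zero against the row of
   ones. *)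
Lemma det_coboundary d l (k : 'I_d) (v : 'I_d.+1 -> 'I_d -> nat) :
  \det (label_mx l v) =
  \sum_(j < d.+1) (-1) ^+ (k + j) * facet_form l k (v \o lift j).
Proof.
set A := label_mx l v; set M := \sum_j l k (v j).
have cof0 : \sum_j cofactor A (lift ord0 k) j = 0.
  have E j : cofactor A (lift ord0 k) j = A ord0 j * (\adj A) j (lift ord0 k).
    by rewrite label_mx0 mul1r mxE.
  under eq_bigr do rewrite E.
  have := mul_mx_adj A => /matrixP /(_ ord0 (lift ord0 k)).
  by rewrite mxE [RHS]mxE (negbTE (neq_lift _ _)) mulr0n.
rewrite (expand_det_row _ (lift ord0 k)).
transitivity (\sum_j (A (lift ord0 k) j - M) * cofactor A (lift ord0 k) j).
  under [RHS]eq_bigr do rewrite mulrBl.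
  by rewrite sumrB -mulr_sumr cof0 mulr0 subr0.
apply: eq_bigr => j _; rewrite label_mxS /facet_form /cofactor.
have -> : row' (lift ord0 k) (col' j A) =
          row' (lift ord0 k) (label_mx l (v \o lift j)).
  by apply/matrixP => a b; rewrite !mxE.
have -> : l k (v j) - M = - \sum_m l k ((v \o lift j) m).
  by rewrite /M (bigD1_ord j) //=; ring.
by rewrite lift0 addSn exprS; ring.
Qed.

(** The shift differs from the cyclic shift, a bijection of the grid, only at the wraparound, where
    coordinate [i0] is [p] for one and [0] for the other; [H] vanishes in both cases. *)
Lemma sum_shift_grid n p (i0 : 'I_n) (H : ('I_n -> nat) -> R) :
  (forall q, q i0 = 0%N \/ q i0 = p -> H q = 0) ->
  \sum_(q : {ffun 'I_n -> 'I_p}) H (fun i => q i + (i == i0))%N =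
  \sum_(q : {ffun 'I_n -> 'I_p}) H (fun i => q i).
Proof.
move=> H0.
pose r (q : {ffun 'I_n -> 'I_p}) :=
  [ffun i => if i == i0 then ordS (q i) else q i].
have r_inj : injective r.
  move=> q q' /ffunP eq; apply/ffunP => i; move: (eq i); rewrite !ffunE.
  by case: eqP => // _ /ordS_inj.
rewrite [RHS](reindex_inj r_inj) /=; apply: eq_bigr => q _.
have [lt|ge] := ltnP (q i0).+1 p.
  congr H; apply/funext => i; rewrite ffunE.
  case: eqP => [->|_] /=; last by rewrite addn0.
  by rewrite modn_small // addn1.
have e : (q i0).+1 = p by apply/eqP; rewrite eqn_leq ltn_ord.
rewrite !H0 //; last by right; rewrite eqxx addn1.
by left; rewrite ffunE eqxx /= e modnn.
Qed.

(* The [j]-th vertex of the Freudenthal simplex of the unit cube at [q] in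
   which coordinate [i] is increased at step [tau i]. *)
Definition vertex d (q : 'I_d -> nat) (tau : 'S_d) (j : nat) : 'I_d -> nat :=
  fun i => (q i + (tau i < j))%N.

(** The sign of [tau] is the orientation of the simplex, so this is [d!] times the total oriented
    volume of the images. *)
Definition degree d p (l : 'I_d -> ('I_d -> nat) -> R) : R :=
  \sum_(tau : 'S_d) (-1) ^+ tau * \sum_(q : {ffun 'I_d -> 'I_p})
    \det (label_mx l (fun j : 'I_d.+1 => vertex (fun i => q i) tau j)).

(** If [i0 = k], the sum of the values of label [k] vanishes. Otherwise the row of label [i0]
    survives in the determinant and is constant, so [det_const_row] applies. *)
Lemma facet_form_boundary d p l (k i0 : 'I_d) (w : 'I_d -> 'I_d -> nat) c :
  (forall x, x k = 0%N \/ x k = p -> l k x = 0) ->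
  (forall i x y, x i = y i -> x i = 0%N \/ x i = p -> l i x = l i y) ->
  c = 0%N \/ c = p -> (forall m, w m i0 = c) -> facet_form l k w = 0.
Proof.
move=> lk lc hc wc; rewrite /facet_form.
have [e|ne] := eqVneq i0 k.
  rewrite big1 ?mul0r // => m _; apply: lk; rewrite -e wc //.
have /unlift_some[a ea _] : lift ord0 k != ord0 by rewrite eq_sym neq_lift.
have /unlift_some[b eb _] : lift ord0 k != lift ord0 i0.
  by rewrite (inj_eq lift_inj) eq_sym.
have ab : a != b by rewrite -(inj_eq (@lift_inj _ (lift ord0 k))) -ea -eb neq_lift.
rewrite (det_const_row ab (c := l i0 (fun=> c))) ?mulr0 // => j.
  by rewrite !mxE -ea unlift_none.
by rewrite !mxE -eb liftK; apply: lc; rewrite wc.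
Qed.

(* By [det_coboundary] the degree is a sum over the facets of all simplices.  A
   facet opposite an interior vertex of the path from [q] to [q + 1] is shared
   with the simplex obtained by a transposition of [tau]; the one opposite
   vertex 0 of a simplex is opposite the last vertex of the simplex at
   [q + e_i], [tau i = 0].  Shared facets cancel and the remaining ones lie on
   the boundary, where the form vanishes. *)
Lemma degree_eq0 d p l (k : 'I_d.+1) :
  (forall x, x k = 0%N \/ x k = p -> l k x = 0) ->
  (forall i x y, x i = y i -> x i = 0%N \/ x i = p -> l i x = l i y) ->
  degree p l = 0.
Proof.
move=> lk lc.
pose X (j : 'I_d.+2) := \sum_(tau : 'S_d.+1) (-1) ^+ tau *
  \sum_(q : {ffun 'I_d.+1 -> 'I_p})
    facet_form l k (fun m => vertex (fun i => q i) tau (lift j m)).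
have -> : degree p l = \sum_(j < d.+2) (-1) ^+ (k + j) * X j.
  have E (tau : 'S_d.+1) :
      (-1) ^+ tau * \sum_(q : {ffun 'I_d.+1 -> 'I_p}) \det (label_mx l
        (fun j : 'I_d.+2 => vertex (fun i => q i) tau j)) =
      \sum_(j < d.+2) (-1) ^+ (k + j) * ((-1) ^+ tau *
        \sum_(q : {ffun 'I_d.+1 -> 'I_p})
          facet_form l k (fun m => vertex (fun i => q i) tau (lift j m))) :> R.
    under eq_bigr do rewrite (det_coboundary _ k).
    rewrite exchange_big mulr_sumr; under eq_bigr do rewrite -mulr_sumr mulrCA.
    by [].
  rewrite /degree; under eq_bigr do rewrite E.
  by rewrite exchange_big; under eq_bigr do rewrite -mulr_sumr.
have X_interior (j : 'I_d.+2) : (0 < j < d.+1)%N -> X j = 0.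
  move=> /andP[j0 jd].
  have jd' : (j.-1 < d.+1)%N by lia.
  pose a := Ordinal jd'; pose b := Ordinal jd; pose t := tperm a b.
  have ab : a != b by rewrite -val_eqE /=; lia.
  suff : X j = - X j.
    by move/eqP; rewrite -subr_eq0 opprK -mulr2n mulrn_eq0 => /eqP.
  rewrite {1}/X (reindex_inj (mulIg t)) -sumrN; apply: eq_bigr => tau _.
  rewrite odd_permM odd_tperm ab signr_addb mulrN1 mulNr; congr (- (_ * _)).
  apply: eq_bigr => q _; congr facet_form; apply/funext => m.
  apply/funext => i; rewrite /vertex permM; congr (_ + nat_of_bool _)%N.
  have va : a = j.-1 :> nat by [].
  have vb : b = j :> nat by [].
  (* Swapping the values [j - 1] and [j] of [tau] affects the test [_ < m'] only for [m' = j], the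
     omitted vertex. *)
  have : lift j m != j by rewrite eq_sym neq_lift.
  move: (lift j m) => m'; rewrite -val_eqE /= => nm.
  by case: tpermP => [->|->|//]; apply/idP/idP; rewrite ?va ?vb; lia.
have X_ends : X ord_max = (-1) ^+ d * X ord0.
  (* The cycle [c] sends [0] to [d] and lowers every other index by one, so the first direction of
     the path becomes the last; its sign is [(-1)^d]. *)
  pose c : 'S_d.+1 := lift_perm ord0 ord_max 1%g.
  rewrite /X (reindex_inj (mulIg c)) mulr_sumr; apply: eq_bigr => tau _.
  rewrite odd_permM odd_lift_perm odd_perm1 addbF /= signr_addb signr_odd.
  rewrite mulrA [_ * (-1) ^+ d]mulrC; congr (_ * _).
  pose i0 := (tau^-1)%g ord0.
  have tau_i0 : tau i0 = ord0 by rewrite permKV.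
  have c0 : (tau * c)%g i0 = ord_max by rewrite permM tau_i0 lift_perm_id.
  pose H q := facet_form l k (fun m : 'I_d.+1 => vertex q (tau * c)%g m).
  transitivity (\sum_(q : {ffun 'I_d.+1 -> 'I_p}) H (fun i => q i)).
    apply: eq_bigr => q _; congr facet_form.
    by apply/funext => m; congr vertex; apply: (lift_max m).
  (* Without its last vertex the simplex keeps coordinate [i0] equal to [q i0]; if this is [0] or
     [p], the facet lies on the boundary. *)
  rewrite -(sum_shift_grid (i0 := i0)); last first.
    move=> q hq; apply: (facet_form_boundary (i0 := i0) lk lc hq) => m.
    by rewrite /vertex c0 /= ltnNge -ltnS ltn_ord addn0.
  apply: eq_bigr => q _; congr facet_form; apply/funext => m.
  apply/funext => i; rewrite /vertex [bump _ _]lift0 -addnA; congr (_ + _)%N.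
  have [->|ne] := eqVneq i i0.
    by rewrite c0 tau_i0 /= ltnNge -ltnS ltn_ord.
  rewrite permM; case: (unliftP ord0 (tau i)) => [x ex|e].
    by rewrite ex lift_perm_lift perm1 lift_max lift0 ltnS add0n.
  by move: ne; rewrite /i0 -e permK eqxx.
rewrite big_ord_recl big_ord_recr /= big1 => [|i _].
  rewrite (_ : lift ord0 ord_max = ord_max); last exact/val_inj.
  rewrite X_ends add0r !exprD /= expr0 exprS.
  have : ((-1) ^+ d * (-1) ^+ d = 1 :> R).
    by rewrite -exprMn mulrNN mulr1 expr1n.
  by move=> e; ring: e.
by rewrite X_interior ?mulr0 // lift0 /= ltnS ltn_ord.
Qed.

Definition face_normalized d p (l : 'I_d -> ('I_d -> nat) -> R) :=
  forall i x, (x i = 0%N -> l i x = 0) /\ (x i = p -> l i x = 1).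

(** Each determinant is linear in the row of label [k], so the degrees differ by the degree with
    [l k - l' k] as label [k]. This label vanishes on both of its faces, and [degree_eq0]
    applies. *)
Lemma degree_change_row d p (l l' : 'I_d.+1 -> ('I_d.+1 -> nat) -> R) k :
  face_normalized p l -> face_normalized p l' ->
  (forall i, i != k -> l i = l' i) -> degree p l = degree p l'.
Proof.
move=> fl fl' ll'.
pose l'' i x := if i == k then l i x - l' i x else l i x.
have -> : degree p l = degree p l' + degree p l''.
  rewrite /degree -big_split /=; apply: eq_bigr => tau _.
  rewrite -mulrDr -big_split /=; congr (_ * _); apply: eq_bigr => q _.
  pose v (j : 'I_d.+2) := vertex (fun i => q i) tau j.
  rewrite (@determinant_multilinear _ _ _ (label_mx l' v) (label_mx l'' v)
    (lift ord0 k) 1 1) ?mul1r //.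
  - apply/rowP => j; rewrite !mxE liftK /l'' eqxx !mul1r; ring.
  - apply/matrixP => a b; rewrite !mxE; case: unliftP => // i ei.
    rewrite -ll' //; apply/eqP => ik; move: ei; rewrite ik.
    by move/eqP; rewrite eq_sym (negbTE (neq_lift _ _)).
  - apply/matrixP => a b; rewrite !mxE; case: unliftP => // i ei.
    rewrite /l''; case: eqP => // ik; move: ei; rewrite ik.
    by move/eqP; rewrite eq_sym (negbTE (neq_lift _ _)).
rewrite (degree_eq0 (l := l'') (k := k)) ?addr0 // => [x hx|i x y xy hx].
  rewrite /l'' eqxx; case: (fl k x) (fl' k x) => [l0 lp] [l0' lp'].
  by case: hx => hx; [rewrite l0 // l0' // | rewrite lp // lp' //]; rewrite subrr.
have [l0x lpx] := fl i x; have [l0y lpy] := fl i y.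
have [l0x' lpx'] := fl' i x; have [l0y' lpy'] := fl' i y.
have lxy : l i x = l i y.
  by case: hx => hx; [rewrite l0x // l0y // -xy | rewrite lpx // lpy // -xy].
have lxy' : l' i x = l' i y.
  by case: hx => hx; [rewrite l0x' // l0y' // -xy | rewrite lpx' // lpy' // -xy].
by rewrite /l'' lxy lxy'.
Qed.

Lemma degree_unique d p (l l' : 'I_d.+1 -> ('I_d.+1 -> nat) -> R) :
  face_normalized p l -> face_normalized p l' -> degree p l = degree p l'.
Proof.
move=> fl fl'.
pose h m (i : 'I_d.+1) := if (i < m)%N then l' i else l i.
have fh m : face_normalized p (h m) by move=> i x; rewrite /h; case: ifP.
have E m : degree p (h m) = degree p (h 0%N).
  elim: m => // m <-; have [md|dm] := ltnP m d.+1; last first.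
    congr degree; apply/funext => i; rewrite /h.
    by have := ltn_ord i; rewrite !(leq_trans (ltn_ord i)) // (leq_trans dm).
  apply: (degree_change_row (k := Ordinal md)) => // i ne; rewrite /h.
  suff -> : (i < m.+1)%N = (i < m)%N by [].
  by rewrite ltnS leq_eqVlt -[(i == m :> nat)]/(i == Ordinal md) (negbTE ne).
have -> : l = h 0%N by apply/funext.
rewrite -(E d.+1); congr degree; apply/funext => i.
by rewrite /h ltn_ord.
Qed.

Definition positivity d (i : 'I_d) (x : 'I_d -> nat) : R := (0 < x i)%:R.

(** If some [q i] is positive, label [i] is constantly 1 on the simplex. At the origin, label [i]
    switches on right after step [tau i], so the matrix is a unitriangular one with rows permuted by
    [tau]. *)
Lemma det_positivity d p (q : {ffun 'I_d.+1 -> 'I_p}) (tau : 'S_d.+1) :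
  \det (label_mx (@positivity d.+1)
    (fun j : 'I_d.+2 => vertex (fun i => q i) tau j)) =
  (-1) ^+ tau * [forall i, q i == 0 :> nat]%:R.
Proof.
have [/forallP q0|/forallPn[i qi]] := boolP [forall i, q i == 0 :> nat]; last first.
  rewrite mulr0; apply: (det_const_row (neq_lift ord0 i) (c := 1)) => j.
    exact: label_mx0.
  by rewrite label_mxS /positivity /vertex addn_gt0 lt0n qi.
pose T : 'M[R]_d.+2 := \matrix_(i, j) (i <= j)%:R.
have -> : label_mx (@positivity d.+1)
    (fun j : 'I_d.+2 => vertex (fun i => q i) tau j) =
    row_perm (lift_perm ord0 ord0 tau) T.
  apply/matrixP => i j; rewrite !mxE; case: unliftP => [k ->|->].
    by rewrite lift_perm_lift lift0 /positivity /vertex (eqP (q0 k)) add0n lt0b.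
  by rewrite lift_perm_id.
rewrite row_permE det_mulmx det_perm odd_lift_perm /= mulr1.
rewrite -det_tr det_trig; last first.
  apply/is_trig_mxP => i j ij; rewrite !mxE leqNgt ij //.
by rewrite big1 ?mulr1 // => i _; rewrite !mxE leqnn.
Qed.

Lemma degree_positivity d p : degree p.+1 (@positivity d.+1) = (d.+1)`!%:R.
Proof.
rewrite /degree; under eq_bigr => tau _.
  under eq_bigr do rewrite det_positivity.
  rewrite -mulr_sumr mulrA -signr_addb addbb mul1r.
  rewrite (bigD1 [ffun=> ord0]) //= big1 => [|q q0].
    rewrite addr0 (_ : [forall i, _] = true); last first.
      by apply/forallP => i; rewrite ffunE.
    over.
  case: forallP => // q0'; case/eqP: q0; apply/ffunP => i.
  by apply/val_inj; rewrite ffunE /=; apply/eqP.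
by rewrite sumr_const card_Sn.
Qed.

Lemma exists_full_cube d p (l : 'I_d.+1 -> ('I_d.+1 -> nat) -> R) :
  (0 < p)%N -> face_normalized p l ->
  exists q : 'I_d.+1 -> nat, (forall i, q i < p)%N /\
    forall k, exists u v : 'I_d.+1 -> nat,
      [/\ forall i, (q i <= u i <= (q i).+1)%N,
          forall i, (q i <= v i <= (q i).+1)%N & l k u != l k v].
Proof.
case: p => // p _ fl.
have : degree p.+1 l != 0.
  rewrite (degree_unique fl (l' := @positivity d.+1)); last first.
    by move=> i x; rewrite /positivity; split=> ->.
  by rewrite degree_positivity pnatr_eq0 -lt0n fact_gt0.
move=> /eqP dl; apply: contrapT => no; apply: dl.
rewrite /degree big1 // => tau _; rewrite big1 ?mulr0 // => q _.
set v := fun j : 'I_d.+2 => _.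
apply: contrapT => /eqP dv; apply: no; exists (fun i => nat_of_ord (q i)); split=> // k.
apply: contrapT => nok; case/eqP: dv.
apply: (det_const_row (neq_lift ord0 k) (c := l k (v ord0))) => j.
  exact: label_mx0.
rewrite label_mxS; apply: contrapT => /eqP ne; apply: nok; exists (v j), (v ord0).
by split => // i; rewrite /v /vertex; case: (_ < _)%N; rewrite /= ?addn1 ?addn0 leqnn leqnSn.
Qed.

End KuhnDegree.

(** * Brouwer's and Kakutani's theorems on the unit cube *)

Section Kakutani.
Variable R : realType.

Lemma rV_ballI d (x y : 'rV[R]_d) (e : R) :
  0 < e -> (forall i, `|x ord0 i - y ord0 i| < e) -> ball x e y.
Proof. by move=> e0 H; split=> // i j; rewrite ord1; apply: H. Qed.

Lemma rV_ballE d (x y : 'rV[R]_d) (e : R) i :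
  ball x e y -> `|x ord0 i - y ord0 i| < e.
Proof. by case=> _; apply. Qed.

Lemma continuous_ball (V W : pseudoMetricType R) (f : V -> W) x (e : R) :
  {for x, continuous f} -> 0 < e ->
  exists2 d : R, 0 < d & forall y, ball x d y -> ball (f x) e (f y).
Proof.
move=> fx e0; have /nbhs_ballP[d /= d0 Hd] := fx _ (nbhsx_ballx (f x) e e0).
by exists d.
Qed.

Lemma exists_natSinv_lt (e : R) : 0 < e -> exists n : nat, n.+1%:R^-1 < e.
Proof. by move=> /ltr_add_invr[n]; rewrite add0r => ?; exists n. Qed.

(** The point [t] is a cluster point of points chosen for the tolerances [1/(n+1)]. The tolerance
    [e'] is part of the conclusion because [P] is not assumed monotone. *)
Lemma compact_approx (M : pseudoMetricType R) (K : set M) (P : R -> set M) :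
  compact K -> (forall e, 0 < e -> exists2 c, K c & P e c) ->
  exists2 t, K t & forall d e, 0 < d -> 0 < e ->
    exists e' c, [/\ 0 < e' < e, K c, P e' c & ball t d c].
Proof.
move=> cK KP.
have /choice[u uP] : forall n : nat, exists c, K c /\ P n.+1%:R^-1 c.
  by move=> n; have [|c ? ?] := KP n.+1%:R^-1; [rewrite invr_gt0 | exists c].
have [|t [Kt clt]] := cK (u @ \oo) _ _.
  by exists 0%N => // n _; have [] := uP n.
exists t => // d e d0 e0; have [N Ne] := exists_natSinv_lt e0.
have [|_ [[n Nn <-] td]] :=
  clt [set u n | n in [set n | (N <= n)%N]] (ball t d) _ (nbhsx_ballx t d d0).
  by exists N => // n Nn; exists n.
exists n.+1%:R^-1, (u n); have [Kn Pn] := uP n; split => //.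
rewrite invr_gt0 ltr0n /= (le_lt_trans _ Ne) //.
by rewrite lef_pV2 ?posrE // ler_nat ltnS.
Qed.

(** * Brouwer's theorem on the unit cube *)

Definition unit_cube d : set 'rV[R]_d :=
  [set t : 'rV[R]_d | forall i, 0 <= t ord0 i <= 1].

Lemma unit_cube_compact d : compact (@unit_cube d).
Proof.
have := @rV_compact R d (fun=> `[0, 1 : R]%classic) (fun=> @segment_compact R 0 1).
by congr compact; apply/seteqP; split=> t Ht i; have := Ht i; rewrite /= in_itv.
Qed.

Lemma kuhn_approx d (g : 'rV[R]_d.+1 -> 'rV[R]_d.+1) (e : R) :
  (forall t, unit_cube t -> unit_cube (g t)) -> 0 < e ->
  exists2 c, unit_cube c & forall k, exists a b,
    [/\ unit_cube a, unit_cube b, ball c e a, ball c e b &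
        g a ord0 k <= a ord0 k /\ b ord0 k <= g b ord0 k].
Proof.
move=> gC e0; have [n ne] := exists_natSinv_lt e0.
have p0 : 0 < n.+1%:R :> R by rewrite ltr0n.
pose pt (x : 'I_d.+1 -> nat) : 'rV[R]_d.+1 := \row_i ((x i)%:R / n.+1%:R).
have pt_cube x : (forall i, x i <= n.+1)%N -> unit_cube (pt x).
  move=> xn i; rewrite mxE divr_ge0 ?ler0n //= ler_pdivrMr // mul1r ler_nat.
  exact: xn.
(* Label 1 says that [g] does not raise coordinate [i], label 0 that it does not lower it. The
   values forced on the faces respect this, since [g] maps the cube to itself. *)
pose l (i : 'I_d.+1) x : int := ((0 < x i)%N &&
  ((n.+1 <= x i)%N || (g (pt x) ord0 i <= pt x ord0 i)))%:R.
have fl : face_normalized n.+1 l.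
  by move=> i x; rewrite /l; split=> -> //; rewrite leqnn.
have [q [qn Hq]] := exists_full_cube (ltn0Sn n) fl.
exists (pt q); first by apply: pt_cube => i; rewrite ltnW.
have near u : (forall i, q i <= u i <= (q i).+1)%N ->
    unit_cube (pt u) /\ ball (pt q) e (pt u).
  move=> qu; split.
    by apply: pt_cube => i; have /andP[_ /leq_trans->] := qu i.
  apply: rV_ballI => // i; rewrite !mxE -mulrBl normrM [`|_^-1|]gtr0_norm ?invr_gt0 //.
  apply: le_lt_trans ne; rewrite ler_piMl ?invr_ge0 ?ler0n //.
  rewrite distrC ger0_norm ?subr_ge0 ?ler_nat; last by case/andP: (qu i).
  by rewrite lerBlDl natr1 ler_nat; case/andP: (qu i).
have lT k u : (forall i, q i <= u i <= (q i).+1)%N -> l k u = 1 ->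
    g (pt u) ord0 k <= pt u ord0 k.
  move=> qu; rewrite /l; case: andP => // -[_ /orP[nu|//]] _.
  have [/gC/(_ k)/andP[_ g1] _] := near u qu.
  by apply: (le_trans g1); rewrite mxE ler_pdivlMr // mul1r ler_nat.
have lF k u : (forall i, q i <= u i <= (q i).+1)%N -> l k u != 1 ->
    pt u ord0 k <= g (pt u) ord0 k.
  move=> qu; rewrite /l; have [/gC/(_ k)/andP[g0 _] _] := near u qu.
  have [uk _|u0] := posnP (u k); first by rewrite [leLHS]mxE uk mul0r.
  case: (leqP n.+1 (u k)) => //= _; case: leP => // /ltW //.
move=> k; have [u [v [qu qv luv]]] := Hq k.
have [Cu Bu] := near u qu; have [Cv Bv] := near v qv.
have l01 x : l k x = 1 \/ l k x = 0 by rewrite /l; case: (_ && _); [left|right].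
have [lu|lu] := eqVneq (l k u) 1.
  exists (pt u), (pt v); split=> //; split; first exact: lT.
  by apply: lF => //; rewrite -lu eq_sym.
exists (pt v), (pt u); split=> //; split; last exact: lF.
apply: lT => //; case: (l01 v) => // lv; case: (l01 u) => lu'.
  by rewrite lu' eqxx in lu.
by rewrite lu' lv eqxx in luv.
Qed.

Lemma brouwer_cube d (g : 'rV[R]_d -> 'rV[R]_d) :
  (forall t, unit_cube t -> unit_cube (g t)) ->
  (forall t, unit_cube t -> {for t, continuous g}) ->
  exists2 t, unit_cube t & g t = t.
Proof.
case: d g => [|d] g gC gc.
  by exists 0; [case | apply/rowP; case].
have [t Ct Ht] :=
  compact_approx (@unit_cube_compact d.+1) (fun e => @kuhn_approx d g e gC).
exists t => //; apply/rowP => k.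
(* A nearby [a] bounds the difference above and a nearby [b] below, each with an error [e] for the
   point and [e] for its image. *)
suff H (e : R) : 0 < e -> `|g t ord0 k - t ord0 k| <= e + e.
  apply/eqP; rewrite -subr_eq0 -normr_eq0 eq_le normr_ge0 andbT.
  apply/ler_addgt0Pr => e e0; rewrite add0r [e in leRHS]splitr.
  by apply: H; rewrite divr_gt0.
move=> e0; have [dl dl0 Hdl] := continuous_ball (gc t Ct) e0.
pose m := Num.min dl e; have m0 : 0 < m by rewrite lt_min dl0.
have m20 : 0 < m / 2 by rewrite divr_gt0.
have [e' [c [/andP[_ e'm] Cc /(_ k)[a [b [Ca Cb ca cb [ga gb]]]] tc]]] :=
  Ht _ _ m20 m20.
have near x : ball c e' x -> `|t ord0 k - x ord0 k| < e /\
    `|g t ord0 k - g x ord0 k| < e.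
  move=> cx; have tx : ball t m x.
    by apply: (ball_split tc); apply: le_ball cx; apply: ltW.
  split.
    by apply: rV_ballE; apply: le_ball tx; rewrite ge_min lexx orbT.
  by apply: rV_ballE; apply: Hdl; apply: le_ball tx; rewrite ge_min lexx.
have [] := near a ca; have [] := near b cb.
rewrite !ltr_norml ler_norml => /andP[? ?] /andP[? ?] /andP[? ?] /andP[? ?].
by apply/andP; split; lra.
Qed.

(** * Convex combinations and continuous weights *)

Definition segment_closed (V : lmodType R) (A : set V) :=
  forall x y (a : R), A x -> A y -> 0 <= a <= 1 -> A (a *: x + (1 - a) *: y).

(** By induction: the barycenter lies on the segment from [y i] to the barycenter of the remaining
    points. Zero weights put no condition on [y], as is needed for grid points far away. *)
Lemma segment_closed_barycenter (V : lmodType R) (A : set V) (I : eqType)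
    (r : seq I) (w : I -> R) (y : I -> V) :
  segment_closed A -> (forall i, 0 <= w i) -> (forall i, 0 < w i -> A (y i)) ->
  0 < \sum_(i <- r) w i ->
  A ((\sum_(i <- r) w i)^-1 *: \sum_(i <- r) w i *: y i).
Proof.
move=> cA w0 wA; elim: r => [|i r IH]; first by rewrite !big_nil ltxx.
rewrite !big_cons; set W := \sum_(j <- r) w j; set Y := \sum_(j <- r) w j *: y j.
have W0 : 0 <= W by apply: sumr_ge0.
have [wi0|wi0] := eqVneq (w i) 0; first by rewrite wi0 scale0r !add0r.
have wi : 0 < w i by rewrite lt_neqAle eq_sym wi0 w0.
have [We|We] := eqVneq W 0.
  have -> : Y = 0.
    move/eqP: We; rewrite /W psumr_eq0 // => /allP W0'.
    by rewrite /Y big_seq big1 // => j /W0'/eqP ->; rewrite scale0r.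
  by move=> _; rewrite We !addr0 scalerA mulVf // scale1r; apply: wA.
have Wp : 0 < W by rewrite lt_neqAle eq_sym We W0.
move=> wW.
have -> : (w i + W)^-1 *: (w i *: y i + Y) =
    (w i / (w i + W)) *: y i + (1 - w i / (w i + W)) *: (W^-1 *: Y).
  rewrite scalerDr !scalerA mulrC; congr (_ + _ *: _).
  by field; rewrite We gt_eqF.
apply: cA; [exact: wA | exact: IH |].
apply/andP; split; first exact: divr_ge0 (ltW wi) (ltW wW).
by rewrite ler_pdivrMr // mul1r lerDl.
Qed.

(* [`|a| + a = 2 max(a, 0)]. *)
Definition tent (V : normedModType R) (e : R) (v x : V) : R :=
  `|e - `|x - v| | + (e - `|x - v|).

Lemma tent_ge0 (V : normedModType R) e (v x : V) : 0 <= tent e v x.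
Proof. by rewrite /tent -lerBlDr sub0r ler_normr lexx orbT. Qed.

Lemma tent_gt0 (V : normedModType R) e (v x : V) : (0 < tent e v x) = (`|x - v| < e).
Proof.
rewrite /tent -[RHS]subr_gt0; case: (ltP 0 (e - `|x - v|)) => [lt|ge]; first by rewrite ltr_wpDl.
by rewrite ler0_norm // addNr ltxx.
Qed.

Lemma tent_continuous (V : normedModType R) e (v : V) : continuous (tent e v).
Proof.
move=> x; have c1 : (fun y => e - `|y - v|) y @[y --> x] --> e - `|x - v|.
  apply: cvgB; first exact: cvg_cst.
  by apply: cvg_norm; apply: cvgB; [exact: cvg_id | exact: cvg_cst].
by apply: cvgD; [exact: cvg_norm c1 | exact: c1].
Qed.

Lemma barycenter_continuous (V W : normedModType R) (I : finType)
    (w : I -> V -> R) (y : I -> W) x :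
  (forall i, continuous (w i)) -> \sum_i w i x != 0 ->
  {for x, continuous (fun x => (\sum_i w i x)^-1 *: \sum_i w i x *: y i)}.
Proof.
move=> cw w0; have cS : continuous (fun x => \sum_i w i x).
  by apply: continuous_big => [|i _]; [exact: add_continuous | exact: cw].
have cY : continuous (fun x => \sum_i w i x *: y i).
  apply: continuous_big => [|i _]; first exact: add_continuous.
  by move=> z; apply: cvgZ; [exact: cw | exact: cvg_cst].
by apply: cvgZ; [apply: cvgV => //; exact: cS | exact: cY].
Qed.

(** * Kakutani's theorem on the unit cube *)

Lemma exists_grid_near d n (t : 'rV[R]_d) : unit_cube t ->
  exists q : {ffun 'I_d -> 'I_n.+2},
    ball t (2 / n.+1%:R) (\row_i ((q i)%:R / n.+1%:R)).
Proof.
move=> Ct; have p0 : 0 < n.+1%:R :> R by rewrite ltr0n.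
pose m i := Num.truncn (t ord0 i * n.+1%:R).
have mP i : (m i)%:R <= t ord0 i * n.+1%:R < (m i).+1%:R.
  by apply: truncn_itv; rewrite mulr_ge0 ?ler0n //; case/andP: (Ct i).
have mn i : (m i < n.+2)%N.
  rewrite ltnS -(ler_nat R); case/andP: (mP i) => /le_trans + _; apply.
  by rewrite -[leRHS]mul1r ler_wpM2r ?ler0n //; case/andP: (Ct i).
exists [ffun i => Ordinal (mn i)].
apply: rV_ballI => [|i]; first by rewrite divr_gt0.
rewrite !mxE ffunE /= -[t ord0 i](mulfK (lt0r_neq0 p0)) -mulrBl normrM.
rewrite [`|_^-1|]gtr0_norm ?invr_gt0 // ltr_pM2r ?invr_gt0 //.
have /andP[le lt] := mP i; rewrite ger0_norm ?subr_ge0 //.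
by rewrite ltrBlDl (lt_trans lt) // -[(m i).+1%:R]natr1 ltrD2l ltr1n.
Qed.

(** The quantifier over [A] places [c] in the convex hull of the values of [F] near [c]. Here [c] is
    a Brouwer fixed point of the tent-weighted mean of values chosen at grid points; only those
    within [2/(n+1) < e] of [c] have positive weight. *)
Lemma kakutani_approx d (F : 'rV[R]_d -> set 'rV[R]_d) (e : R) :
  (forall t, unit_cube t -> F t `<=` @unit_cube d) ->
  (forall t, unit_cube t -> F t !=set0) -> 0 < e ->
  exists2 c, unit_cube c & forall A : set 'rV[R]_d, segment_closed A ->
    (forall s, unit_cube s -> ball c e s -> F s `<=` A) -> A c.
Proof.
move=> FC F0 e0; have e20 : 0 < e / 2 by rewrite divr_gt0.
have [n ne] := exists_natSinv_lt e20.
have p0 : 0 < n.+1%:R :> R by rewrite ltr0n.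
have {}ne : 2 / n.+1%:R < e by rewrite mulrC -ltr_pdivlMr.
pose v (q : {ffun 'I_d -> 'I_n.+2}) : 'rV[R]_d := \row_i ((q i)%:R / n.+1%:R).
have Cv q : unit_cube (v q).
  move=> i; rewrite mxE divr_ge0 ?ler0n //= ler_pdivrMr // mul1r ler_nat.
  by rewrite -ltnS ltn_ord.
have /choice[y Fy] : forall q, exists y, F (v q) y by move=> q; exact: F0.
pose w q x := tent (2 / n.+1%:R) (v q) x.
pose S x := \sum_q w q x.
have S0 x : unit_cube x -> 0 < S x.
  move=> /(exists_grid_near n)[q]; rewrite mx_norm_ball => xq.
  rewrite /S (bigD1 q) //= ltr_pwDl ?tent_gt0 //.
  by apply: sumr_ge0 => i _; exact: tent_ge0.
pose g x := (S x)^-1 *: \sum_q w q x *: y q.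
have barycenter (A : set 'rV[R]_d) x : unit_cube x -> segment_closed A ->
    (forall q, 0 < w q x -> A (y q)) -> A (g x).
  move=> Cx cA wA; apply: segment_closed_barycenter => //; last exact: S0.
  by move=> q; exact: tent_ge0.
have gC x : unit_cube x -> unit_cube (g x).
  move=> Cx; apply: barycenter => // [a b l Ca Cb /andP[l0 l1] i|q _].
    rewrite !mxE; have /andP[? ?] := Ca i; have /andP[? ?] := Cb i.
    by apply/andP; split; nra.
  exact: FC (Fy q).
have gc x : unit_cube x -> {for x, continuous g}.
  move=> Cx; apply: barycenter_continuous => [q|]; first exact: tent_continuous.
  by rewrite gt_eqF // S0.
have [c Cc gcc] := brouwer_cube gC gc.
exists c => // A cA HA; rewrite -gcc; apply: barycenter => // q.
rewrite tent_gt0 => cq; apply: (HA (v q)) => //.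
by rewrite mx_norm_ball /=; apply: lt_trans ne.
Qed.

Lemma set_neighborhood_segment_closed (V : normedModType R) (e : R) (A : set V) :
  segment_closed A -> segment_closed (set_neighborhood e A).
Proof.
move=> cA x y l [a Aa ax] [b Ab bY] /andP[l0 l1].
exists (l *: a + (1 - l) *: b); first by apply: cA => //; rewrite l0.
move: ax bY; rewrite -!ball_normE /= => ax bY.
have -> : l *: a + (1 - l) *: b - (l *: x + (1 - l) *: y) =
    l *: (a - x) + (1 - l) *: (b - y).
  by rewrite !scalerBr opprD addrACA.
apply: le_lt_trans (ler_normD _ _) _; rewrite !normrZ.
rewrite !ger0_norm ?subr_ge0 //.
(* For [l = 0] the strict inequality must come from the second term alone. *)
by have [->|] := eqVneq l 0; [rewrite mul0r subr0 mul1r add0r | nra].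
Qed.

Lemma kakutani_cube d (F : 'rV[R]_d -> set 'rV[R]_d) :
  (forall t, unit_cube t ->
    [/\ F t `<=` @unit_cube d, F t !=set0, segment_closed (F t) & closed (F t)]) ->
  (forall t (e : R), unit_cube t -> 0 < e -> exists2 dl : R, 0 < dl &
    forall s, unit_cube s -> ball t dl s -> F s `<=` set_neighborhood e (F t)) ->
  exists2 t, unit_cube t & F t t.
Proof.
move=> HF uF.
have [t Ct Ht] := compact_approx (@unit_cube_compact d) (fun e =>
  @kakutani_approx d F e
  (fun t Ct => let: And4 FC _ _ _ := HF t Ct in FC)
  (fun t Ct => let: And4 _ F0 _ _ := HF t Ct in F0)).
exists t => //; have [_ _ cF clF] := HF t Ct.
apply: clF => B /nbhs_ballP[e /= e0 eB].
have e20 : 0 < e / 2 by rewrite divr_gt0.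
have [dl dl0 Hdl] := uF t _ Ct e20.
have dl20 : 0 < dl / 2 by rewrite divr_gt0.
(* With [c] within [dl/2] of [t] and [e' < dl/2], all values of [F] used for [c] lie in the convex
   [e/2]-neighborhood of [F t], hence so does [c], which is itself within [e/2] of [t]. *)
have m0 : 0 < Num.min (dl / 2) (e / 2) by rewrite lt_min dl20.
have [e' [c [/andP[_ e'm] Cc Hc tc]]] := Ht _ _ m0 dl20.
have [|s Cs cs|a Fa ac] := Hc (set_neighborhood (e / 2) (F t)).
- exact: set_neighborhood_segment_closed.
- apply: Hdl => //; apply: (@ball_split _ _ c).
    by apply: le_ball tc; rewrite ge_min lexx.
  by apply: le_ball cs; apply: ltW.
exists a; split=> //; apply: eB; apply: (@ball_splitl _ _ c) => //.
by apply: le_ball tc; rewrite ge_min lexx orbT.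
Qed.

(** * Transfer to a general cube *)

Lemma mulmx_ball m n (A : 'M[R]_(m, n)) (e : R) : 0 < e ->
  exists2 dl : R, 0 < dl &
    forall x y : 'rV[R]_m, ball x dl y -> ball (x *m A) e (y *m A).
Proof.
(* [B] bounds every absolute column sum; dividing by [B + 1] also covers [A = 0]. *)
move=> e0; pose B := \sum_j \sum_k `|A k j|.
have B0 : 0 <= B by apply: sumr_ge0 => j _; apply: sumr_ge0.
have B1 : 0 < B + 1 by rewrite ltr_wpDl.
exists (e / (B + 1)); first by rewrite divr_gt0.
move=> x y xy; apply: rV_ballI => // j.
rewrite !mxE -sumrB; apply: (@le_lt_trans _ _ (e / (B + 1) * B)); last first.
  by rewrite mulrAC ltr_pdivrMr // ltr_pM2l // ltrDl.
apply: le_trans (ler_norm_sum _ _ _) _.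
apply: (@le_trans _ _ (e / (B + 1) * \sum_k `|A k j|)).
  rewrite mulr_sumr; apply: ler_sum => k _; rewrite -mulrBl normrM.
  by rewrite ler_wpM2r // ltW // rV_ballE.
rewrite ler_wpM2l //; first by rewrite divr_ge0 ?ltW.
rewrite /B [leRHS](bigD1 j) //= lerDl.
by apply: sumr_ge0 => i _; apply: sumr_ge0.
Qed.

End Kakutani.

Lemma convex_set_segment_closed (R : realType) (V : lmodType R) (A : set V) :
  convex_set A -> segment_closed A.
Proof.
move=> cA x y a /mem_set Ax /mem_set Ay /andP[a0 a1].
by have := cA x y (Itv01 a0 a1) Ax Ay; rewrite inE.
Qed.

Theorem theorem4p1 (R : realType) (n d : nat) (C : set 'rV[R]_n)
  (f : set_type C -> set 'rV[R]_n)
  (hC : is_closed_cube d C)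
  (hf : upper_semicontinuous f)
  (hfC : forall x : set_type C,
    [/\ f x `<=` C, f x !=set0, convex_set (f x) & compact (f x)]) :
  exists x : set_type C, f x (set_val x).
Proof.
have [p [s [U [s0 UU CE]]]] := hC.
pose phi (t : 'rV[R]_d) := p + s *: (t *m U).
(* Orthonormality of the rows of [U] makes [psi] a left inverse of [phi], even if [d < n]. *)
pose psi (x : 'rV[R]_n) := s^-1 *: ((x - p) *m U^T).
have phiK : cancel phi psi.
  move=> t; rewrite /psi /phi addrC addKr -scalemxAl scalerA mulVf ?gt_eqF //.
  by rewrite scale1r -mulmxA UU mulmx1.
have CP x : C x <-> exists2 t, unit_cube t & phi t = x by rewrite CE.
have Cphi t : unit_cube t -> C (phi t) by move=> Ct; apply/CP; exists t.
have phi_ball (e : R) : 0 < e -> exists2 dl : R, 0 < dl &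
    forall t t', ball t dl t' -> ball (phi t) e (phi t').
  move=> e0; have [dl dl0 H] := mulmx_ball (s *: U) e0.
  exists dl => // t t' /H; rewrite -!scalemxAr !mx_norm_ball /= /phi.
  by rewrite opprD addrACA subrr add0r.
have psi_ball (e : R) : 0 < e -> exists2 dl : R, 0 < dl &
    forall x x', ball x dl x' -> ball (psi x) e (psi x').
  move=> e0; have [dl dl0 H] := mulmx_ball (s^-1 *: U^T) e0.
  exists dl => // x x' xx'; have := H (x - p) (x' - p).
  rewrite -!scalemxAr; apply; move: xx'; rewrite !mx_norm_ball /=.
  by rewrite opprB addrA subrK.
have phi_cont : continuous phi.
  move=> t B /nbhs_ballP[e /= e0 eB]; have [dl dl0 H] := phi_ball e e0.
  by apply/nbhs_ballP; exists dl => //= t' /H /eB.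
(* The map [f] lives on the subtype of [C], while [F] must be defined on all of ['rV[R]_d]; the
   existential makes [F t] empty off the unit cube. *)
pose F t := [set t' | exists2 x : set_type C, set_val x = phi t & f x (phi t')].
have FE (x : set_type C) t : set_val x = phi t -> F t = phi @^-1` (f x).
  move=> xt; apply/seteqP; split=> t' /=; last by move=> fx; exists x.
  by case=> x' x't; have -> : x' = x by apply: val_inj; exact: etrans x't (esym xt).
pose pt t (Ct : unit_cube t) : set_type C := SigSub (mem_set (Cphi t Ct)).
have ptE t (Ct : unit_cube t) : F t = phi @^-1` (f (pt t Ct)) by apply: FE.
have [t Ct||t Ct [x xt fx]] := @kakutani_cube R d F; last first.
- by exists x; rewrite xt.
(* The moduli compose: [psi] turns [e1] into [e], semicontinuity of [f] turns [e2] into [e1], and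
   [phi] turns [dl] into [e2]. *)
- move=> t e Ct e0; have [e1 e10 He1] := psi_ball e e0.
  have [e2 e20 He2] := hf.2 (pt t Ct) e1 e10.
  have [dl dl0 Hdl] := phi_ball e2 e20.
  exists dl => // t' Ct' tt' y; rewrite (ptE t' Ct') (ptE t Ct) => fy.
  have [a fa ay] := He2 (pt t' Ct') (Hdl _ _ tt') _ fy.
  have [/(_ a fa)/CP[b Cb ba] _ _ _] := hfC (pt t Ct).
  exists b; first by rewrite /= ba.
  by rewrite -[b]phiK -[y]phiK ba; apply: He1.
rewrite (ptE t Ct); have [fC [y fy] cf kf] := hfC (pt t Ct).
have /CP[b Cb by_] := fC y fy; split.
- move=> t' /fC/CP[t'' Ct'' /(can_inj phiK)] <- //.
- by exists b; rewrite /= by_.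
- move=> u v a fu fv a01; rewrite /preimage /=.
  suff -> : phi (a *: u + (1 - a) *: v) = a *: phi u + (1 - a) *: phi v.
    exact: convex_set_segment_closed.
  rewrite /phi mulmxDl -!scalemxAl; move: (u *m U) (v *m U) => u' v'.
  by apply/rowP => i; rewrite !mxE; ring.
- apply: preimage_closed; first by move=> ? _; exact: phi_cont.
  by apply: compact_closed => //; exact: norm_hausdorff.
Qed.
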